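(* For each $n\ge1$ let $a_{n,1},\dots,a_{n,n}$ be the $n$-th roots of unity, and let $T_n$ and $U_{n-1}$ be the Chebyshev rational functions built from the nodes $a_{n,1},\dots,a_{n,n}$ (nodes equal to $\pm1$ being disregarded). Then the multipoint Padé approximants $\dfrac{U_{n-1}}{T_n}$ converge, as $n\to\infty$, to $\phi(x)=\dfrac1{\sqrt{x^2-1}}$ locally uniformly on $\mathbb{C}\setminus[-1,1]$.
   Context: The symbol $\sqrt{x^2-1}$ denotes the branch analytic on $\mathbb{C}\setminus[-1,1]$ with $\sqrt{x^2-1}\sim x$ as $x\to\infty$. For a node $a_{n,k}\in\mathbb{C}\setminus[-1,1]$ put $c_{n,k}=a_{n,k}-\sqrt{a_{n,k}^2-1}$, so $0<|c_{n,k}|<1$ and $a_{n,k}=\frac12(c_{n,k}+c_{n,k}^{-1})$. Define $$f_n(z)=\prod_{\substack{1\le k\le n\\ a_{n,k}\ne\pm1}}\frac{z-c_{n,k}}{1-c_{n,k}z}$$ (empty product $=1$; a node $a_{n,k}=\pm1$ would only contribute a constant factor $\mp1$, does not affect the quotient $U_{n-1}/T_n$, and is disregarded). With $x=\frac12(z+z^{-1})$, $$T_n(x)=\frac12\left(f_n(z)+\frac1{f_n(z)}\right),\qquad U_{n-1}(x)=\frac{1}{z-z^{-1}}\left(f_n(z)-\frac{1}{f_n(z)}\right),$$ which are rational functions of $x$, well defined since both expressions are invariant under $z\mapsto1/z$. The quotient $U_{n-1}/T_n$ is regarded as a rational function (after cancellation of common poles at the nodes). *)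

(* Defs.v *)
From HB Require Import structures.
From mathcomp Require Import all_boot all_order all_algebra.
From mathcomp Require Import generic_quotient fraction.
From mathcomp Require Import complex.
From mathcomp Require Import all_classical all_reals all_analysis.

Set Implicit Arguments.
Unset Strict Implicit.
Unset Printing Implicit Defensive.

Import Order.TTheory GRing.Theory Num.Theory.
Import numFieldNormedType.Exports.

Local Open Scope classical_set_scope.
Local Open Scope ring_scope.

Section RationalFunctions.
Variable F : fieldType.

Definition ratfun := {fraction {poly F}}.

Definition rfC (c : F) : ratfun := FracField.tofrac c%:P.

Definition rfX : ratfun := FracField.tofrac 'X.

(* [repr r] is an arbitrary representative of [r]; dividing by the gcd puts it
   in lowest terms, so that common zeros of numerator and denominator are
   cancelled before evaluating. *)
Definition rfnum (r : ratfun) : {poly F} :=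
  (repr r).1 %/ gcdp (repr r).1 (repr r).2.

Definition rfden (r : ratfun) : {poly F} :=
  (repr r).2 %/ gcdp (repr r).1 (repr r).2.

Definition rfregular (r : ratfun) (x : F) : Prop := (rfden r).[x] != 0.

(* Meaningful only when [rfregular r x]. *)
Definition rfeval (r : ratfun) (x : F) : F := (rfnum r).[x] / (rfden r).[x].

(* The composite r(g) in F(z). *)
Definition rfcomp (r g : ratfun) : ratfun :=
  (map_poly rfC (rfnum r)).[g] / (map_poly rfC (rfden r)).[g].

End RationalFunctions.

Section Chebyshev.
Variable R : realType.
Local Notation C := (R[i]).

Definition slit_plane : set C := ~` [set t%:C%C | t in `[-1 : R, 1]%classic].

Definition sqrt_branch (s : C -> C) : Prop :=
  [/\ forall x, slit_plane x -> s x ^+ 2 = x ^+ 2 - 1,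
      forall x, slit_plane x -> derivable (s : C^o -> C^o) x 1 &
      forall e : R, 0 < e -> exists M : R, forall x : C,
        M%:C%C < `|x| -> `|s x / x - 1| < e%:C%C].

(* [sqrt_branch] determines the values on [slit_plane] only; the values on
   [-1, 1] are arbitrary and never used. *)
Definition sqrtx2m1 : C -> C := xget (fun=> 0) [set s | sqrt_branch s].

Definition node_c (a : C) : C := a - sqrtx2m1 a.

Definition cheb_f n (a : 'I_n -> C) : ratfun C :=
  \prod_(k < n | (a k != 1) && (a k != - 1))
    ((rfX C - rfC (node_c (a k))) / (1 - rfC (node_c (a k)) * rfX C)).

(* x = (z + z^-1) / 2, as an element of C(z) *)
Definition joukowski : ratfun C := 2^-1 * (rfX C + (rfX C)^-1).

(* T_n and U_{n-1} are elements of C(x), determined by their image in C(z)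
   under x = (z + z^-1) / 2. *)
Definition chebT n (a : 'I_n -> C) : ratfun C :=
  xget 0 [set T | rfcomp T joukowski = 2^-1 * (cheb_f a + (cheb_f a)^-1)].

Definition chebU n (a : 'I_n -> C) : ratfun C :=
  xget 0 [set U | rfcomp U joukowski =
    (rfX C - (rfX C)^-1)^-1 * (cheb_f a - (cheb_f a)^-1)].

(* Poles are part of the notion: near each point of [D], almost all the [r n]
   must be pole-free, so that the default value of [rfeval] at a pole plays no
   role. *)
Definition rf_cvg_locally_uniformly (D : set C) (r : nat -> ratfun C)
    (f : C -> C) : Prop :=
  forall x0, D x0 -> exists2 V : set C, nbhs (x0 : C^o) V &
    (\forall n \near \oo, forall x, (V `&` D) x -> rfregular (r n) x) /\
    {uniform V `&` D, (fun n => rfeval (r n) : C -> C^o) @ \oo --> (f : C -> C^o)}.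

End Chebyshev.

(* Main.v *)
Require Import Defs.
From HB Require Import structures.
From mathcomp Require Import all_boot all_order all_algebra.
From mathcomp Require Import generic_quotient fraction.
From mathcomp Require Import complex.
From mathcomp Require Import ring lra.
From mathcomp Require Import all_classical all_reals all_analysis.

Set Implicit Arguments.
Unset Strict Implicit.
Unset Printing Implicit Defensive.

Import Order.TTheory GRing.Theory Num.Theory.
Import numFieldNormedType.Exports.

Local Open Scope classical_set_scope.
Local Open Scope ring_scope.

(** With [z = x - sqrt (x^2 - 1)] one has [x = (z + 1/z) / 2] and
    [sqrt (x^2 - 1) = (1/z - z) / 2], and [x] runs over the slit plane exactly
    when [z] runs over the punctured unit disc. By definition of [T_n] and [U_(n-1)],

      U_(n-1) (x) / T_n (x)
        = 2 / (z - 1/z) * (f_n(z)^2 - 1) / (f_n(z)^2 + 1)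
        = (sqrt (x^2 - 1))^-1 * (1 - f_n(z)^2) / (1 + f_n(z)^2),

    so everything reduces to [f_n(z) -> 0], locally uniformly in the disc.

    The nodes being stable under complex conjugation, so are the [c_k], and
    [|f_n(z)|] is the modulus of the Blaschke product with zeros [c_k]
    ([blaschke_le]). Each squared Blaschke factor is at most
    [1 - (1 - |z|^2) (1 - |c_k|^2) / 4] ([blaschke_factor_le]), and for a node [a]
    on the unit circle [1 - |c|^2 >= |a^2 - 1|^2 / 6] ([node_c_gap]). Finally the
    sum of the [|a_k^2 - 1|^2] over the [n]-th roots of unity is [2 n] as soon as
    [n > 2], because the squares of the roots then add up to zero
    ([sum_roots_sqr]); with [prod_one_sub_le] this makes [|f_n(z)|^2] at most
    [1 / (1 + n (1 - |z|^2) / 12)].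

    Two points need care before this computation applies. The chosen branch
    of the square root is characterised only by its square, analyticity and
    behaviour at infinity: that [|x - sqrt (x^2 - 1)| < 1] on the whole slit plane
    is an intermediate value argument along the rays [t x], [t >= 1]
    ([sqrt_branch_inner]), while existence is [inner_sqrt_branch]. And [T_n],
    [U_(n-1)] are chosen as elements of C(x) with a prescribed image in C(z):
    they exist because [f] splits as [A + h B] with [A], [B] in C(x),
    [h = (z - 1/z) / 2], and [1/f = A - h B], a property stable under products
    ([even_odd_split_cheb_f]). *)

(** * Values and composition of rational functions *)

Section RationalFunctions.
Variable F : fieldType.
Implicit Types (r s g : ratfun F) (p q : {poly F}) (z v w : F).
Local Notation tofrac := (@FracField.tofrac {poly F}).

HB.instance Definition _ :=
  GRing.RMorphism.copy (@rfC F) (tofrac \o polyC).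

Lemma tofrac_neq0 q : q != 0 -> tofrac q != 0.
Proof. by rewrite tofrac_eq0. Qed.

Lemma ratfun_reprE r : r = tofrac (repr r).1 / tofrac (repr r).2.
Proof.
have d0 : tofrac (repr r).2 != 0 by rewrite tofrac_eq0 denom_ratioP.
apply: (mulIf d0); rewrite divfK //.
rewrite -{1}[r]reprK; move: (repr r) d0 => x d0.
rewrite /FracField.tofrac; unlock.
apply/esym; rewrite -[RHS](FracField.pi_mul); apply/eqP.
rewrite (FracField.equivf_def); apply/eqP.
rewrite /FracField.mulf !numden_Ratio ?oner_eq0 ?mulf_neq0 ?denom_ratioP ?oner_eq0 //.
by rewrite mulr1 mul1r.
Qed.

Lemma rfden_neq0 r : rfden r != 0.
Proof.
by rewrite /rfden divp_eq0 !negb_or denom_ratioP gcdp_eq0 negb_and denom_ratioP orbT/= -leqNgt dvdp_leq ?dvdp_gcdr ?denom_ratioP.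
Qed.

Lemma rfnum_rfden_coprime r : coprimep (rfnum r) (rfden r).
Proof. by apply: coprimep_div_gcd; rewrite denom_ratioP orbT. Qed.

Lemma rfnum_rfdenE r : r = tofrac (rfnum r) / tofrac (rfden r).
Proof.
have g0 : gcdp (repr r).1 (repr r).2 != 0 by rewrite gcdp_eq0 negb_and denom_ratioP orbT.
rewrite {1}[r]ratfun_reprE.
rewrite -{1}(divpK (dvdp_gcdl (repr r).1 (repr r).2)).
rewrite -{3}(divpK (dvdp_gcdr (repr r).1 (repr r).2)) !rmorphM /=.
by rewrite invfM mulrACA divff ?mulr1 // tofrac_eq0.
Qed.

(** The value of [r] at [z], as a relation: any fraction representing [r] whose
    denominator does not vanish at [z] may be used, so no reduction to lowest
    terms is needed to compute with it. *)
Definition evalto z r v :=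
  exists n d : {poly F}, [/\ d.[z] != 0, r = tofrac n / tofrac d & v = n.[z] / d.[z]].

Lemma horner_neq0 q z : q.[z] != 0 -> q != 0.
Proof. by apply: contraNneq => ->; rewrite horner0. Qed.

Lemma evalto_inj z r v w : evalto z r v -> evalto z r w -> v = w.
Proof.
move=> [n [d [d0 -> ->]]] [m [e [e0 + ->]]].
have /tofrac_neq0 d1 := horner_neq0 d0; have /tofrac_neq0 e1 := horner_neq0 e0.
move=> /eqP; rewrite (eqr_div _ _ d1 e1) -!tofracM tofrac_eq => /eqP /(congr1 (horner^~ z)).
by rewrite !hornerM => E; apply/eqP; rewrite eqr_div // E.
Qed.

Lemma evalto_poly z p : evalto z (tofrac p) p.[z].
Proof. by exists p, 1; rewrite hornerC oner_eq0 rmorph1 !divr1. Qed.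

Lemma evaltoC z v : evalto z (rfC v) v.
Proof. by have := evalto_poly z v%:P; rewrite hornerC. Qed.

Lemma evaltoX z : evalto z (rfX F) z.
Proof. by have := evalto_poly z 'X; rewrite hornerX. Qed.

Lemma evaltoD z r s v w : evalto z r v -> evalto z s w -> evalto z (r + s) (v + w).
Proof.
move=> [n [d [d0 -> ->]]] [m [e [e0 -> ->]]].
have /tofrac_neq0 d1 := horner_neq0 d0; have /tofrac_neq0 e1 := horner_neq0 e0.
exists (n * e + m * d), (d * e).
rewrite !hornerD !hornerM mulf_neq0 // tofracD !tofracM.
by split; rewrite // (addf_div _ _ d0 e0, addf_div _ _ d1 e1).
Qed.

Lemma evaltoM z r s v w : evalto z r v -> evalto z s w -> evalto z (r * s) (v * w).
Proof.
move=> [n [d [d0 -> ->]]] [m [e [e0 -> ->]]].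
by exists (n * m), (d * e); rewrite !hornerM mulf_neq0 // !tofracM !mulf_div.
Qed.

Lemma evaltoN z r v : evalto z r v -> evalto z (- r) (- v).
Proof.
move=> h; rewrite -mulN1r -[- v]mulN1r; apply: evaltoM => //.
by have := evaltoC z (-1); rewrite rmorphN1.
Qed.

Lemma evaltoB z r s v w : evalto z r v -> evalto z s w -> evalto z (r - s) (v - w).
Proof. by move=> h /evaltoN; exact: evaltoD. Qed.

Lemma evaltoV z r v : v != 0 -> evalto z r v -> evalto z r^-1 v^-1.
Proof.
move=> + [n [d [d0 -> vE]]]; rewrite vE => v0.
exists d, n; rewrite !invfM !invrK ![_^-1 * _]mulrC; split=> //.
by apply: contraNneq v0 => ->; rewrite mul0r.
Qed.

Lemma evalto_prod z (I : Type) (l : seq I) (P : pred I) (f : I -> ratfun F) (h : I -> F) :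
  (forall i, P i -> evalto z (f i) (h i)) ->
  evalto z (\prod_(i <- l | P i) f i) (\prod_(i <- l | P i) h i).
Proof.
move=> fh; apply: (big_ind2 (evalto z)) => //; last by move=> *; exact: evaltoM.
by have := evaltoC z 1; rewrite rmorph1.
Qed.

Lemma evalto_horner z x g p :
  evalto z g x -> evalto z (map_poly (@rfC F) p).[g] p.[x].
Proof.
move=> gx; elim/poly_ind: p => [|p c IH].
  by rewrite rmorph0 !horner0; have := evaltoC z 0; rewrite rmorph0.
rewrite rmorphD rmorphM/= map_polyX map_polyC/= !hornerD !hornerM !hornerX !hornerC.
by apply: evaltoD (evaltoC _ _); exact: evaltoM.
Qed.

(** [g] is transcendental over the constants, so that substitution of [g] is
    a field morphism. *)
Definition rftransc g := forall q, q != 0 -> (map_poly (@rfC F) q).[g] != 0.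

(** Any representative may be used to compute [rfcomp], since no nonzero
    denominator vanishes at [g]. *)
Lemma rfcompE g n d : rftransc g -> d != 0 ->
  rfcomp (tofrac n / tofrac d) g = (map_poly (@rfC F) n).[g] / (map_poly (@rfC F) d).[g].
Proof.
move=> gT d0; rewrite /rfcomp; set r := tofrac n / tofrac d.
apply/eqP; rewrite (eqr_div _ _ (gT _ (rfden_neq0 r)) (gT _ d0)) -!hornerM -!(rmorphM (map_poly (@rfC F))).
suff -> : rfnum r * d = n * rfden r by [].
apply/eqP; rewrite -tofrac_eq !tofracM.
by rewrite -(eqr_div _ _ (tofrac_neq0 (rfden_neq0 r)) (tofrac_neq0 d0)) -rfnum_rfdenE.
Qed.

Lemma rfcomp_tofrac g p : rftransc g ->
  rfcomp (tofrac p) g = (map_poly (@rfC F) p).[g].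
Proof.
move=> gT; rewrite -[tofrac p]divr1 -tofrac1 (rfcompE _ gT (oner_neq0 _)).
by rewrite rmorph1 hornerC divr1.
Qed.

Lemma rfcompC g v : rftransc g -> rfcomp (rfC v) g = rfC v.
Proof. by move=> gT; rewrite rfcomp_tofrac // map_polyC hornerC. Qed.

Lemma rfcompX g : rftransc g -> rfcomp (rfX F) g = g.
Proof. by move=> gT; rewrite rfcomp_tofrac // map_polyX hornerX. Qed.

Lemma rfcompD g r s : rftransc g -> rfcomp (r + s) g = rfcomp r g + rfcomp s g.
Proof.
move=> gT; rewrite {1}[r]rfnum_rfdenE {1}[s]rfnum_rfdenE.
have r0 := rfden_neq0 r; have s0 := rfden_neq0 s.
rewrite (addf_div _ _ (tofrac_neq0 r0) (tofrac_neq0 s0)) -!tofracM -tofracD.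
rewrite (rfcompE _ gT (mulf_neq0 r0 s0)) rmorphD !rmorphM/= !hornerD !hornerM.
by rewrite -(addf_div _ _ (gT _ r0) (gT _ s0)).
Qed.

Lemma rfcompM g r s : rftransc g -> rfcomp (r * s) g = rfcomp r g * rfcomp s g.
Proof.
move=> gT; rewrite {1}[r]rfnum_rfdenE {1}[s]rfnum_rfdenE.
have r0 := rfden_neq0 r; have s0 := rfden_neq0 s.
rewrite mulf_div -!tofracM (rfcompE _ gT (mulf_neq0 r0 s0)).
by rewrite !rmorphM/= !hornerM -mulf_div.
Qed.

Lemma rfcompB g r s : rftransc g -> rfcomp (r - s) g = rfcomp r g - rfcomp s g.
Proof.
move=> gT; rewrite -[- s]mulN1r -(rmorphN1 (@rfC F)).
by rewrite (rfcompD _ _ gT) (rfcompM _ _ gT) (rfcompC _ gT) rmorphN1 mulN1r.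
Qed.

Lemma rfcompV g r : rftransc g -> rfcomp r^-1 g = (rfcomp r g)^-1.
Proof.
move=> gT; have [->|r0] := eqVneq r 0.
  by rewrite invr0 -(rmorph0 (@rfC F)) rfcompC // rmorph0 invr0.
have e : rfcomp r^-1 g * rfcomp r g = 1.
  by rewrite -rfcompM // mulVf // -(rmorph1 (@rfC F)) rfcompC.
have n0 : rfcomp r g != 0.
  by apply: contra_eq_neq e => ->; rewrite mulr0 eq_sym oner_eq0.
by apply: (mulIf n0); rewrite e mulVf.
Qed.

(** If [r (g)] has a finite value at [z] and [g] has value [x] there, then
    [r] has no pole at [x]: a zero of the reduced denominator at [x] would also be a
    zero of the numerator, against coprimality. *)
Lemma rfeval_comp g r x z v : rftransc g -> evalto z g x ->
  evalto z (rfcomp r g) v -> rfregular r x /\ rfeval r x = v.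
Proof.
move=> gT gx rv.
have E : rfcomp r g * (map_poly (@rfC F) (rfden r)).[g] = (map_poly (@rfC F) (rfnum r)).[g].
  by rewrite /rfcomp divfK ?gT ?rfden_neq0.
have nE : v * (rfden r).[x] = (rfnum r).[x].
  apply: (@evalto_inj z (map_poly (@rfC F) (rfnum r)).[g]); last exact: evalto_horner.
  by rewrite -E; apply: evaltoM => //; exact: evalto_horner.
have d0 : (rfden r).[x] != 0.
  apply/negP => /[dup] d0; rewrite -[_ == 0]/(root _ _).
  move/(coprimep_root); move=> /(_ (rfnum r)); rewrite coprimep_sym rfnum_rfden_coprime.
  by move=> /(_ isT); rewrite -nE (eqP d0) mulr0 eqxx.
by split=> //; rewrite /rfeval -nE mulfK.
Qed.

End RationalFunctions.

(** * The modulus as a real number *)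

Section Modulus.
Variable R : realType.
Local Notation C := (R[i]).
Implicit Types x y z : C.

(** Real-valued, so that comparisons take place in a total order, unlike
    those of [`|x|], which lies in [R[i]]. *)
Definition modulus x : R := Normc.normc x.

Definition modsq x : R := complex.Re x ^+ 2 + complex.Im x ^+ 2.

Lemma norm_modulus x : `|x| = (modulus x)%:C%C.
Proof. by rewrite normc_def; case: x. Qed.

Lemma modulusD x y : modulus (x + y) <= modulus x + modulus y.
Proof. exact: le_normcD. Qed.

Lemma modulusM x y : modulus (x * y) = modulus x * modulus y.
Proof. exact: Normc.normcM. Qed.

Lemma modulusV x : modulus x^-1 = (modulus x)^-1.
Proof. exact: Normc.normcV. Qed.

Lemma modulusN x : modulus (- x) = modulus x.
Proof. exact: normcN. Qed.

Lemma modulus_ge0 x : 0 <= modulus x.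
Proof. by rewrite -lecR -norm_modulus normr_ge0. Qed.

Lemma modulus_gt0 x : (0 < modulus x) = (x != 0).
Proof. by rewrite -ltcR -norm_modulus normr_gt0. Qed.

Lemma modulus_real (t : R) : modulus t%:C%C = `|t|.
Proof. by rewrite /modulus /= expr0n addr0 sqrtr_sqr. Qed.

Lemma modulus_Im0 x : complex.Im x = 0 -> modulus x = `|complex.Re x|.
Proof. by case: x => a b /= ->; exact: modulus_real. Qed.

Lemma modulus_sqr x : modulus x ^+ 2 = modsq x.
Proof.
by case: x => a b; rewrite /modulus /modsq /= sqr_sqrtr // addr_ge0 ?sqr_ge0.
Qed.

Lemma modsq_ge0 x : 0 <= modsq x.
Proof. by rewrite addr_ge0 ?sqr_ge0. Qed.

Lemma modsqM x y : modsq (x * y) = modsq x * modsq y.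
Proof. by rewrite -!modulus_sqr modulusM exprMn. Qed.

Lemma modsq1 : modsq 1 = 1.
Proof. by rewrite /modsq /= expr1n expr0n addr0. Qed.

Lemma modsqV x : modsq x^-1 = (modsq x)^-1.
Proof. by rewrite -!modulus_sqr modulusV exprVn. Qed.

Lemma modsq_eq0 x : (modsq x == 0) = (x == 0).
Proof.
by rewrite -modulus_sqr sqrf_eq0 eq_le modulus_ge0 andbT leNgt modulus_gt0 negbK.
Qed.

Lemma modsq_gt0 x : (0 < modsq x) = (x != 0).
Proof. by rewrite lt_neqAle modsq_ge0 andbT eq_sym modsq_eq0. Qed.

Lemma modulus_lt1 x : (modulus x < 1) = (modsq x < 1).
Proof. by rewrite -modulus_sqr expr_lt1 ?modulus_ge0. Qed.

Lemma Re_le_modulus x : `|complex.Re x| <= modulus x.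
Proof. by have := normc_ge_Re x; rewrite norm_modulus lecR. Qed.

Lemma Im_le_modulus x : `|complex.Im x| <= modulus x.
Proof.
case: x => a b; rewrite /modulus /= -sqrtr_sqr ler_wsqrtr //.
by rewrite lerDr sqr_ge0.
Qed.

End Modulus.

(** * The branch of the square root *)

Section SqrtBranch.
Variable R : realType.
Local Notation C := (R[i]).
Implicit Types x y z w : C.

Lemma slit_planeP x :
  slit_plane x <-> complex.Im x != 0 \/ 1 < `|complex.Re x|.
Proof.
split; rewrite /slit_plane /=.
  move=> xs; case: (eqVneq (complex.Im x) 0) => [x0|]; [right|by left].
  rewrite ltNge; apply/negP; rewrite ler_norml => xi; apply: xs.
  exists (complex.Re x); rewrite /= ?in_itv //=.
  by case: x x0 {xi} => a b /= ->.
move=> h [t]; rewrite /= in_itv/= -ler_norml => t1 tx.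
case: h; rewrite -tx /= ?eqxx // => /lt_le_trans/(_ t1).
by rewrite ltxx.
Qed.

Lemma slit_modulus_gt1 x : 1 < modulus x -> slit_plane x.
Proof.
move=> x1; apply/slit_planeP; have [x0|] := eqVneq (complex.Im x) 0; [right|by left].
by rewrite -modulus_Im0.
Qed.

(** The slit plane is star-shaped with respect to infinity. *)
Lemma slit_ray x (t : R) : 1 <= t -> slit_plane x -> slit_plane (t%:C%C * x).
Proof.
move=> t1 /slit_planeP h; apply/slit_planeP; have t0 : 0 < t by lra.
case: x h => a b /= [h|h]; [left|right]; rewrite mul0r ?addr0 ?subr0.
  by rewrite mulf_neq0 // gt_eqF.
by rewrite normrM (gtr0_norm t0); nra.
Qed.

Lemma slit_open x : slit_plane x ->
  exists2 d : R, 0 < d & forall y, modulus (y - x) < d -> slit_plane y.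
Proof.
move=> /slit_planeP [h|h].
  exists `|complex.Im x|; first by rewrite normr_gt0.
  move=> y yx; apply/slit_planeP; left; apply: contraTneq yx => y0.
  rewrite -leNgt; apply: le_trans (Im_le_modulus _).
  by rewrite [complex.Im (y - x)]raddfB /= y0 sub0r normrN.
exists (`|complex.Re x| - 1); first by rewrite subr_gt0.
move=> y yx; apply/slit_planeP; right.
have := Re_le_modulus (y - x); rewrite raddfB/= distrC.
have := lerB_dist (complex.Re x) (complex.Re y); lra.
Qed.

Lemma slit_neq0 x : slit_plane x -> x != 0.
Proof.
move=> /slit_planeP; apply: contraPneq => -> /=; rewrite eqxx normr0 ltr10.
by case.
Qed.

Lemma slit_sqr_neq1 x : slit_plane x -> x ^+ 2 - 1 != 0.
Proof.
move=> xs; rewrite subr_eq0 sqrf_eq1; apply/negP => h.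
have : 1 < `|complex.Re x| \/ complex.Im x != 0 by apply/or_comm/slit_planeP.
by case/orP: h => /eqP -> /=; rewrite ?oppr0 eqxx ?normrN normr1 ltxx; case.
Qed.

(** [x - s] and [x + s] are the two roots [z], [1/z] of [z^2 - 2 x z + 1]. *)
Lemma sqrt_roots x s : s ^+ 2 = x ^+ 2 - 1 -> (x - s) * (x + s) = 1.
Proof. by move=> sE; rewrite -subr_sqr sE; ring. Qed.

(** If [w = x - s] has modulus 1 then [1/w] is its conjugate, hence
    [x = Re w] lies on the slit. *)
Lemma slit_modsq_neq1 x s : slit_plane x -> s ^+ 2 = x ^+ 2 - 1 ->
  modsq (x - s) != 1.
Proof.
move=> + /sqrt_roots E; have [w wE] : exists w, w = x - s by exists (x - s).
rewrite -wE in E *; have -> : x = (w + (x + s)) / 2 by rewrite wE; field.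
move: (x + s) E => W E /slit_planeP h; apply/negP => /eqP w1; case: w {wE} E w1 h => a b E.
rewrite /modsq /= => ab; have w0 : (a +i* b)%C != 0 :> C.
  by apply/negP => /eqP e; move: E; rewrite e mul0r => /eqP; rewrite eq_sym oner_eq0.
have -> : W = (a -i* b)%C.
  apply: (mulfI w0); rewrite E; apply/eqP; rewrite eq_complex /=.
  by apply/andP; split; apply/eqP; lra.
have -> : ((a +i* b)%C + (a -i* b)%C) / 2 = a%:C%C :> C.
  apply: (@mulIf _ 2); rewrite ?divfK ?pnatr_eq0 //.
  by apply/eqP; rewrite eq_complex /=; apply/andP; split; apply/eqP; lra.
rewrite /= eqxx => -[//|]; rewrite ltNge => /negP; apply.
by rewrite -(@expr_le1 _ 2) // ?real_normK ?num_real //; nra.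
Qed.

(** The branch singled out by choosing, among the roots [z], [1/z] of
    [z^2 - 2 x z + 1], the one inside the unit disc. *)
Definition inner_branch (s : C -> C) :=
  forall x, slit_plane x -> s x ^+ 2 = x ^+ 2 - 1 /\ modsq (x - s x) < 1.

Lemma inner_branch_ex : exists s, inner_branch s.
Proof.
pose t x := sqrtc (x ^+ 2 - 1).
exists (fun x => if modsq (x - t x) < 1 then t x else - t x) => x xs.
have tE : t x ^+ 2 = x ^+ 2 - 1 by rewrite sqr_sqrtc.
case: ltP => [//|h]; rewrite sqrrN opprK; split=> //.
have := congr1 (@modsq R) (sqrt_roots tE); rewrite modsqM modsq1.
have := slit_modsq_neq1 xs tE.
have := modsq_ge0 (x + t x); move: h; rewrite le_eqVlt eq_sym => /orP[->//|].
nra.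
Qed.

Lemma inner_unique x s t : s ^+ 2 = x ^+ 2 - 1 -> t ^+ 2 = x ^+ 2 - 1 ->
  modsq (x - s) < 1 -> modsq (x - t) < 1 -> s = t.
Proof.
move=> sE tE s1 t1; have /eqP : t ^+ 2 = s ^+ 2 by rewrite sE tE.
rewrite eqf_sqr => /orP[/eqP ->//|/eqP ts].
have := congr1 (@modsq R) (sqrt_roots sE); rewrite modsqM modsq1.
rewrite ts opprK in t1 => /eqP; rewrite lt_eqF //.
by rewrite mulr_ilt1 ?modsq_ge0.
Qed.

(** As [s y ^+ 2] is close to [s x ^+ 2], the value [s y] is close to [s x] or
    to [- s x]. In the latter case [y - s y], of modulus less than 1, would be close
    to [x + s x], of modulus greater than 1. *)
Lemma inner_continuous s x (e : R) : inner_branch s -> slit_plane x -> 0 < e ->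
  exists2 d : R, 0 < d &
    forall y, slit_plane y -> modulus (y - x) < d -> modulus (s y - s x) < e.
Proof.
move=> sI xs e0; have [sxE wx] := sI x xs.
have W1 : 1 < modulus (x + s x).
  have := congr1 (@modulus R) (sqrt_roots sxE); rewrite modulusM.
  have -> : modulus 1 = 1 :> R by rewrite -[1]/(1%:C%C) modulus_real normr1.
  move: wx; rewrite -modulus_lt1; have := modulus_ge0 (x - s x).
  have := modulus_ge0 (x + s x); nra.
set W := modulus (x + s x) in W1.
(* [n] is the accuracy for [s]; the bound by (W - 1) / 2 is what excludes the
   wrong sign. *)
have [n [n0 ne nW]] : exists n : R, [/\ 0 < n, n <= e & n <= (W - 1) / 2].
  by exists (Num.min e ((W - 1) / 2)); rewrite lt_min !ge_min !lexx orbT e0; split=> //; lra.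
have m0 := modulus_ge0 x; set m := modulus x in m0.
have [d [d0 d1 dn dW]] : exists d : R, [/\ 0 < d, d <= 1, d * (2 * m + 1) < n ^+ 2
    & d <= (W - 1) / 2].
  pose d' := n ^+ 2 / (2 * m + 2).
  have d'0 : 0 < d' by rewrite divr_gt0 ?exprn_gt0 //; lra.
  have d'E : d' * (2 * m + 2) = n ^+ 2 by rewrite divfK // gt_eqF //; lra.
  exists (Num.min d' (Num.min 1 ((W - 1) / 2))).
  have h : Num.min d' (Num.min 1 ((W - 1) / 2)) <= d' by rewrite ge_min lexx.
  rewrite !lt_min d'0 ltr01 /=; split; rewrite ?ge_min ?lexx ?orbT //.
  - lra.
  - by apply: (@le_lt_trans _ _ (d' * (2 * m + 1))); [apply: ler_wpM2r; lra | nra].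
exists d => // y ys yx; have [syE wy] := sI y ys.
have E : modulus (s y - s x) * modulus (s y + s x) = modulus (y - x) * modulus (y + x).
  by rewrite -!modulusM; congr modulus; rewrite -!subr_sqr syE sxE; ring.
have yx2 : modulus (y + x) <= 2 * m + 1.
  have -> : y + x = (y - x) + (x + x) by ring.
  have := modulusD (y - x) (x + x); have := modulusD x x; rewrite -/m; lra.
have lt2 : modulus (s y - s x) * modulus (s y + s x) < n ^+ 2.
  rewrite E; apply: le_lt_trans dn; apply: ler_pM; rewrite ?modulus_ge0 //.
  exact: ltW.
suff ltn : modulus (s y - s x) < n by lra.
rewrite ltNge; apply/negP => gen.
have sn : modulus (s y + s x) < n.
  rewrite ltNge; apply/negP => gen2; move: lt2; rewrite ltNge => /negP; apply.
  by rewrite expr2; apply: ler_pM => //; lra.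
have := modulusD (x - y + (s y + s x)) (y - s y).
have -> : x - y + (s y + s x) + (y - s y) = x + s x by ring.
have := modulusD (x - y) (s y + s x).
rewrite -[x - y]opprB modulusN -/W; move: wy; rewrite -modulus_lt1; lra.
Qed.

End SqrtBranch.

Section Existence.
Variable R : realType.
Local Notation C := (R[i]).
Implicit Types x y z w : C.

Lemma nbhs_modulus (x : C^o) (P : set C) :
  (exists2 d : R, 0 < d & forall y, modulus (y - x) < d -> P y) -> nbhs x P.
Proof.
move=> [d d0 dP]; apply/(@nbhs_normP _ C^o); exists d%:C%C; first by rewrite /= ltcR.
by move=> y; rewrite /= norm_modulus ltcR -opprB modulusN; exact: dP.
Qed.

Lemma nbhs_modulusP (x : C^o) (P : set C) :
  nbhs x P -> exists2 d : R, 0 < d & forall y, modulus (y - x) < d -> P y.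
Proof.
move=> /(@nbhs_normP _ C^o)[d /= d0 dP].
have dE : d = (complex.Re d)%:C%C by rewrite RRe_real // gtr0_real.
exists (complex.Re d); first by rewrite -ltcR -dE.
by move=> y yx; apply: dP; rewrite /= norm_modulus dE ltcR -opprB modulusN.
Qed.

(** The difference quotient is [(2 x + h) / (s (x + h) + s x)], because
    [s ^+ 2] is [x ^+ 2 - 1]; continuity of [s] gives the limit. *)
Lemma inner_sqrt_derivable (s : C^o -> C^o) (x : C^o) : inner_branch s -> slit_plane x ->
  derivable s x 1.
Proof.
move=> sI xs; have sx0 : s x != 0.
  by rewrite -sqrf_eq0 (sI x xs).1 slit_sqr_neq1.
have cs : s (h + x) @[h --> (0 : C^o)] --> s x.
  apply/(@cvgrPdist_lt _ C^o _ (nbhs (0 : C^o)) _) => e e0.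
  have eE : e = (complex.Re e)%:C%C by rewrite RRe_real // gtr0_real.
  have {}e0 : 0 < complex.Re e by rewrite -ltcR -eE.
  have [d d0 dP] := inner_continuous sI xs e0.
  have [d' d'0 d'P] := slit_open xs.
  apply: nbhs_modulus; exists (Num.min d d'); first by rewrite lt_min d0.
  move=> h; rewrite subr0 lt_min => /andP[hd hd'] /=.
  rewrite norm_modulus eE ltcR -opprB modulusN.
  by apply: dP; [apply: d'P|]; rewrite addrK.
have sxx0 : s x + s x != 0 by rewrite -mulr2n mulrn_eq0 negb_or.
apply: (@cvgP _ _ ((0 + (x + x)) * (s x + s x)^-1 : C^o)).
have cid : h @[h --> (0 : C^o)^'] --> (0 : C^o) by exact: cvg_within.
have cs' : s (h + x) @[h --> (0 : C^o)^'] --> s x.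
  by apply: cvg_trans cs; apply: cvg_app; exact: cvg_within.
have F0 : Filter (0 : C^o)^' := dnbhs_filter _.
have c1 : h + (x + x) @[h --> (0 : C^o)^'] --> 0 + (x + x).
  by apply: (@cvgD _ C^o _ _ _ _ _ _ _ cid); exact: cvg_cst.
have c2 : s (h + x) + s x @[h --> (0 : C^o)^'] --> s x + s x.
  by apply: (@cvgD _ C^o _ _ _ _ _ _ _ cs'); exact: cvg_cst.
have lim : (h + (x + x)) * (s (h + x) + s x)^-1 @[h --> (0 : C^o)^'] -->
   (0 + (x + x)) * (s x + s x)^-1.
  have c3 := cvgV sxx0 c2; exact: (@cvgM C _ _ F0 _ _ _ _ c1 (c3 F0)).
apply: cvg_trans lim; apply: near_eq_cvg.
have [d d0 dP] := slit_open xs.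
have nzero : \forall h \near (0 : C^o)^', s (h + x) + s x != 0.
  have sxxN : 0 < `|s x + s x| by rewrite normr_gt0.
  move/(@cvgrPdist_lt _ C^o _ ((0 : C^o)^') _)/(_ _ sxxN) : c2.
  apply: filterS => h; rewrite /=.
  by apply: contraTneq => ->; rewrite subr0 ltxx.
have slith : \forall h \near (0 : C^o)^', slit_plane (h + x).
  apply: cvg_within; apply: nbhs_modulus; exists d => // h.
  by rewrite subr0 => hd; apply: dP; rewrite addrK.
near=> h.
have h0 : h != 0 by near: h; exact: nbhs_dnbhs_neq.
have hs : slit_plane (h + x) by near: h.
have hn : s (h + x) + s x != 0 by near: h.
rewrite /= /GRing.scale /= mulr1.
apply: (mulfI h0); apply: (mulIf hn); rewrite !mulrA divff // mul1r.
rewrite -subr_sqr (sI _ hs).1 (sI _ xs).1 mulfVK //; ring.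
Unshelve. all: by end_near. Qed.

Lemma modulus1 : modulus (1 : C) = 1.
Proof. by rewrite -[1]/(1%:C%C) modulus_real normr1. Qed.

(** At infinity [|s x - x| < 1], hence [s x / x] tends to 1. *)
Lemma inner_sqrt_branch (s : C -> C) : inner_branch s -> sqrt_branch s.
Proof.
move=> sI; split=> [x xs|x xs|e e0]; first exact: (sI x xs).1.
  exact: inner_sqrt_derivable.
exists (1 + e^-1) => x; rewrite !norm_modulus !ltcR => xM.
have ei : 0 < e^-1 by rewrite invr_gt0.
have [] := sI x (@slit_modulus_gt1 _ x _); first lra.
move=> _; rewrite -modulus_lt1 -opprB modulusN => sx.
have x0 : x != 0 by rewrite -modulus_gt0; lra.
have -> : s x / x - 1 = (s x - x) / x by rewrite mulrBl divff.
rewrite modulusM modulusV ltr_pdivrMr; last by lra.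
have : e * (1 + e^-1) < e * modulus x by rewrite ltr_pM2l.
by rewrite mulrDr divff ?gt_eqF //; lra.
Qed.

Lemma sqrt_branch_continuous (s : C -> C) x (e : R) : sqrt_branch s ->
  slit_plane x -> 0 < e ->
  exists2 d : R, 0 < d & forall y, modulus (y - x) < d -> modulus (s y - s x) < e.
Proof.
move=> [_ sD _] xs e0.
have /derivable1_diffP/differentiable_continuous := sD x xs.
move=> /(@cvgrPdist_lt _ C^o _ (nbhs (x : C^o)) _)/(_ e%:C%C).
rewrite ltcR => /(_ e0) /nbhs_modulusP[d d0 dP]; exists d => // y yx.
by have := dP y yx; rewrite /= norm_modulus ltcR -opprB modulusN.
Qed.

(** On the ray [t x], [t >= 1], the modulus of [t x - s (t x)] is continuous
    and never equal to 1, and it is less than 1 for large [t], because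
    [s (t x) / (t x)] tends to 1. *)
Lemma sqrt_branch_inner (s : C -> C) : sqrt_branch s -> inner_branch s.
Proof.
move=> sB; have [sE _ sinf] := sB => x xs; split; first exact: sE.
have m0 : 0 < modulus x by rewrite modulus_gt0 slit_neq0.
have [M MP] := sinf 2^-1 ltac:(rewrite invr_gt0; lra).
pose h (t : R) := modulus (t%:C%C * x - s (t%:C%C * x)).
have hneq1 t : 1 <= t -> h t != 1.
  move=> t1; have ts := slit_ray t1 xs.
  apply/eqP => ht; have := slit_modsq_neq1 ts (sE _ ts).
  by rewrite -modulus_sqr -/(h t) ht expr1n eqxx.
(* Far enough on the ray for [s y / y] to be within 1/2 of 1. *)
pose b := 1 + (`|M| + 1) / modulus x.
have bE : b * modulus x = modulus x + `|M| + 1 by rewrite mulrDl divfK ?gt_eqF //; lra.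
have b1 : 1 <= b.
  by rewrite lerDl divr_ge0 ?modulus_ge0 // addr_ge0.
have bs := slit_ray b1 xs.
have hb : h b < 1.
  rewrite /h; set y := (b%:C%C * x) in bs *.
  have yE : modulus y = modulus x + `|M| + 1.
    by rewrite /y modulusM modulus_real ger0_norm // (le_trans ler01 b1).
  have y0 : y != 0 by rewrite slit_neq0.
  have My : M < modulus y by have := ler_norm M; lra.
  have := MP y; rewrite !norm_modulus !ltcR => /(_ My).
  have -> : s y / y - 1 = (s y - y) / y by rewrite mulrBl divff.
  rewrite modulusM modulusV ltr_pdivrMr; last by rewrite modulus_gt0.
  move=> near; have := congr1 (@modulus R) (sqrt_roots (sE _ bs)).
  rewrite -/y modulusM modulus1.
  have := modulusD (y + s y) (y - s y); have -> : y + s y + (y - s y) = y + y by ring.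
  have := modulusD (y + y) (- y); rewrite addrK modulusN.
  have -> : modulus (y + y) = 2 * modulus y.
    by rewrite -mulr2n -[y *+ 2]mulr_natl modulusM -[2]/(2%:R) -(rmorph_nat (real_complex R)) modulus_real ger0_norm.
  move: near; rewrite -opprB modulusN.
  have := modulus_ge0 (y - s y); have := normr_ge0 M; nra.
rewrite -modulus_lt1; suff : h 1 < 1 by rewrite /h mul1r.
rewrite ltNge; apply/negP => h1.
have hc : {within `[1, b], continuous h}.
  apply: continuous_in_subspaceT => t; rewrite inE /= in_itv /= => /andP[t1 _].
  have ts := slit_ray t1 xs.
  apply/cvgrPdist_lt => e e0.
  have e2 : 0 < e / 2 by lra.
  have [d d0 dP] := sqrt_branch_continuous sB ts e2.
  have q0 : 0 < Num.min d (e / 2) / modulus x by rewrite divr_gt0 // lt_min d0.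
  apply/nbhs_normP; exists (Num.min d (e / 2) / modulus x) => // t' /=.
  rewrite distrC ltr_pdivlMr // lt_min => /andP[tx1 tx2].
  have tx : modulus (t'%:C%C * x - t%:C%C * x) = `|t' - t| * modulus x.
    by rewrite -mulrBl modulusM -rmorphB modulus_real.
  rewrite -tx in tx1 tx2; have := dP _ tx1; rewrite /h.
  set y' := (t'%:C%C * x) in tx1 tx2 *; set y := (t%:C%C * x) in tx1 tx2 *.
  rewrite ltr_norml => sy.
  have := modulusD (y' - s y') ((y - y') + (s y' - s y)).
  have := modulusD (y - y') (s y' - s y).
  have -> : y' - s y' + ((y - y') + (s y' - s y)) = y - s y by ring.
  have := modulusD (y - s y) ((y' - y) - (s y' - s y)).
  have := modulusD (y' - y) (- (s y' - s y)).
  have -> : y - s y + ((y' - y) - (s y' - s y)) = y' - s y' by ring.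
  rewrite modulusN -[y - y']opprB modulusN; lra.
have hm : Num.min (h 1) (h b) <= 1 <= Num.max (h 1) (h b).
  by rewrite ge_min le_max h1 (ltW hb) orbT.
have [c] := IVT b1 hc hm.
rewrite in_itv /= => /andP[c1 _] /eqP; exact/negP/hneq1.
Qed.

Lemma sqrtx2m1_branch : sqrt_branch (@sqrtx2m1 R).
Proof.
apply: (@xgetPex _ (fun=> 0) [set s | sqrt_branch s]).
by have [s /inner_sqrt_branch sB] := inner_branch_ex R; exists s.
Qed.

Lemma sqrtx2m1_inner : inner_branch (@sqrtx2m1 R).
Proof. exact: sqrt_branch_inner sqrtx2m1_branch. Qed.

End Existence.

(** * The Chebyshev rational functions *)

Section FieldIdentities.
Variable K : fieldType.
Implicit Types f g h w A B : K.

Lemma conj_pair_mul f g h A B A' B' :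
  f = A + h * B -> f^-1 = A - h * B -> g = A' + h * B' -> g^-1 = A' - h * B' ->
  f * g = (A * A' + h ^+ 2 * (B * B')) + h * (A * B' + B * A') /\
  (f * g)^-1 = (A * A' + h ^+ 2 * (B * B')) - h * (A * B' + B * A').
Proof. by move=> fE fV gE gV; rewrite invfM fV gV fE gE; split; ring. Qed.

(** A factor of [f_n] as [A + h B] with [A] and [B] fractions in [J]: the common
    denominator is [(X - c) (1 - c X) / X], affine in [J]. *)
Lemma conj_pair_factor (X c : K) : (2 : K) != 0 -> X != 0 -> X - c != 0 -> 1 - c * X != 0 ->
  let J := 2^-1 * (X + X^-1) in let h := 2^-1 * (X - X^-1) in
  let D := 1 + c * c - 2 * c * J in
   (X - c) / (1 - c * X) = ((1 + c * c) * J - 2 * c) / D + h * ((1 - c * c) / D) /\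
   ((X - c) / (1 - c * X))^-1 = ((1 + c * c) * J - 2 * c) / D - h * ((1 - c * c) / D).
Proof.
move=> two X0 Xc cX J h D.
have DE : D = (X - c) * (1 - c * X) / X by rewrite /D /J; field; rewrite two X0.
rewrite DE /J /h; split; field; rewrite ?two ?X0 ?Xc ?cX //.
Qed.

Lemma half_diff_sqr (X : K) : (2 : K) != 0 -> X != 0 ->
  (2^-1 * (X - X^-1)) ^+ 2 = (2^-1 * (X + X^-1)) * (2^-1 * (X + X^-1)) - 1.
Proof. by move=> two X0; field; rewrite two X0. Qed.

Lemma sum_conj_pair A B : (A + B) + (A - B) = 2 * A.
Proof. ring. Qed.

Lemma diff_conj_pair A B : (A + B) - (A - B) = 2 * B.
Proof. ring. Qed.

Lemma cheb_quotient f w : f != 0 ->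
  (w^-1 * (f - f^-1)) / (2^-1 * (f + f^-1)) = 2 / w * ((f * f - 1) / (f * f + 1)).
Proof.
move=> f0; have -> : f - f^-1 = (f * f - 1) / f by field.
have -> : f + f^-1 = (f * f + 1) / f by field.
rewrite !invfM !invrK; move: (f * f - 1) (f * f + 1)^-1 w^-1 => a b v.
rewrite -[RHS]mulr1 -(divff f0); ring.
Qed.

End FieldIdentities.

Section ChebyshevValue.
Variable R : realType.
Local Notation C := (R[i]).
Local Notation J := (joukowski R).
Local Notation X := (rfX C).
Local Notation phi r := (rfcomp r J).

Lemma evalto2 z : evalto z (2 : ratfun C) 2.
Proof. by have := evaltoC z (2 : C); rewrite rmorph_nat. Qed.

Lemma evaltoV2 z : evalto z (2^-1 : ratfun C) 2^-1.
Proof. by apply: evaltoV (evalto2 z); rewrite pnatr_eq0. Qed.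

Lemma evalto1 z : evalto z (1 : ratfun C) 1.
Proof. by have := evaltoC z (1 : C); rewrite rmorph1. Qed.

Lemma evalto_joukowski (z : C) : z != 0 -> evalto z J (2^-1 * (z + z^-1)).
Proof.
move=> z0; apply: evaltoM (evaltoV2 z) _; apply: evaltoD (evaltoX z) _.
exact: evaltoV (evaltoX z).
Qed.

(** Every [x] is of the form [(z + 1/z) / 2], so a polynomial vanishing at the
    Joukowski function vanishes everywhere. *)
Lemma joukowski_transc : rftransc J.
Proof.
move=> q /closed_nonrootP[x qx].
pose t := sqrtc (x ^+ 2 - 1).
have E := sqrt_roots (sqr_sqrtc (x ^+ 2 - 1) : t ^+ 2 = _).
have z0 : x - t != 0.
  by apply/negP => /eqP e; move: E; rewrite e mul0r => /eqP; rewrite eq_sym oner_eq0.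
have zV : (x - t)^-1 = x + t by apply: (mulfI z0); rewrite divff.
have := evalto_horner q (evalto_joukowski z0).
have -> : 2^-1 * (x - t + (x - t)^-1) = x by rewrite zV; field.
move=> qE; apply: contraNneq qx => q0; rewrite q0 in qE.
have e0 : evalto (x - t) (0 : ratfun C) 0 by have := evaltoC (x - t) (0 : C); rewrite rmorph0.
by rewrite /root (evalto_inj qE e0).
Qed.

Local Notation JT := joukowski_transc.

Lemma rfX_neq0 : X != 0.
Proof. by rewrite tofrac_eq0 polyX_eq0. Qed.

Lemma two_neq0 : (2 : ratfun C) != 0.
Proof. by rewrite -(rmorph_nat (@rfC C)) tofrac_eq0 polyC_eq0 pnatr_eq0. Qed.

Local Notation h := (2^-1 * (X - X^-1)).

(** [C(z)] is quadratic over the image of [C(x)], generated by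
    [h = (z - 1/z) / 2] with [h^2 = x^2 - 1], and [h] is changed to [- h] by [z -> 1/z].
    The condition says that [f (1/z) = 1 / f(z)]. *)
Definition even_odd_split (f : ratfun C) := exists A B : ratfun C,
  f = phi A + h * phi B /\ f^-1 = phi A - h * phi B.

Lemma even_odd_split1 : even_odd_split 1.
Proof.
exists (rfC 1), (rfC 0); rewrite !(rfcompC _ JT) !rmorph1 !rmorph0 mulr0 addr0 subr0.
by rewrite invr1.
Qed.

Lemma half_diff_rfX_sqr : h ^+ 2 = phi (X * X - rfC 1).
Proof.
rewrite (rfcompB _ _ JT) (rfcompM _ _ JT) (rfcompC _ JT) (rfcompX JT) rmorph1.
exact: half_diff_sqr two_neq0 rfX_neq0.
Qed.

Lemma even_odd_splitM f g :
  even_odd_split f -> even_odd_split g -> even_odd_split (f * g).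
Proof.
move=> [A [B [fE fV]]] [A' [B' [gE gV]]].
have [E1 E2] := conj_pair_mul fE fV gE gV.
exists (A * A' + (X * X - rfC 1) * (B * B')), (A * B' + B * A').
by rewrite !(rfcompD _ _ JT) !(rfcompM _ _ JT) -half_diff_rfX_sqr; split.
Qed.

Lemma rfXsubC_neq0 (c : C) : X - rfC c != 0.
Proof. by rewrite -tofracB tofrac_eq0 polyXsubC_eq0. Qed.

Lemma one_sub_rfCX_neq0 (c : C) : 1 - rfC c * X != 0.
Proof.
rewrite -tofrac1 -tofracM -tofracB tofrac_eq0; apply: (@horner_neq0 _ _ 0).
by rewrite !hornerE subr0 oner_neq0.
Qed.

Lemma even_odd_split_factor (c : C) :
  even_odd_split ((X - rfC c) / (1 - rfC c * X)).
Proof.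
have [E1 E2] := conj_pair_factor two_neq0 rfX_neq0 (rfXsubC_neq0 c) (one_sub_rfCX_neq0 c).
pose D := rfC (1 + c * c) - rfC (2 * c) * X.
have DE : phi D = 1 + rfC c * rfC c - 2 * rfC c * J.
  rewrite /D (rfcompB _ _ JT) (rfcompM _ _ JT) !(rfcompC _ JT) (rfcompX JT).
  by rewrite rmorphD !rmorphM /= rmorph1 rmorph_nat.
exists ((rfC (1 + c * c) * X - rfC (2 * c)) / D), (rfC (1 - c * c) / D).
rewrite !(rfcompM _ _ JT) !(rfcompV _ JT) DE (rfcompB _ _ JT) (rfcompM _ _ JT) !(rfcompC _ JT) (rfcompX JT).
by rewrite rmorphB rmorphD !rmorphM /= rmorph1 rmorph_nat.
Qed.

Lemma even_odd_split_cheb_f n (a : 'I_n -> C) : even_odd_split (cheb_f a).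
Proof.
apply: (big_ind even_odd_split).
- exact: even_odd_split1.
- exact: even_odd_splitM.
- by move=> k _; exact: even_odd_split_factor.
Qed.

Lemma chebTE n (a : 'I_n -> C) : phi (chebT a) = 2^-1 * (cheb_f a + (cheb_f a)^-1).
Proof.
apply: (@xgetPex _ 0 [set T | phi T = 2^-1 * (cheb_f a + (cheb_f a)^-1)]).
have [A [B [-> ->]]] := even_odd_split_cheb_f a; exists A => /=.
by rewrite sum_conj_pair mulKf // two_neq0.
Qed.

Lemma rfX_sub_inv_neq0 : X - X^-1 != 0.
Proof.
apply/negP => /eqP e.
have : evalto 2 (X - X^-1) (2 - 2^-1).
  by apply: evaltoB (evaltoX _) (evaltoV _ (evaltoX _)); rewrite pnatr_eq0.
rewrite e => /evalto_inj => /(_ 0).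
have e0 : evalto 2 (0 : ratfun C) 0 by have := evaltoC 2 (0 : C); rewrite rmorph0.
move=> /(_ e0) /eqP; rewrite subr_eq0 => /eqP /(congr1 ( *%R 2)).
rewrite divff ?pnatr_eq0 // -natrM => /eqP; by rewrite pnatr_eq1.
Qed.

Lemma chebUE n (a : 'I_n -> C) :
  phi (chebU a) = (X - X^-1)^-1 * (cheb_f a - (cheb_f a)^-1).
Proof.
apply: (@xgetPex _ 0 [set U | phi U = (X - X^-1)^-1 * (cheb_f a - (cheb_f a)^-1)]).
have [A [B [-> ->]]] := even_odd_split_cheb_f a; exists B => /=.
rewrite diff_conj_pair -mulrA (mulVKf two_neq0).
by rewrite (mulKf rfX_sub_inv_neq0).
Qed.

Lemma cheb_f_neq0 n (a : 'I_n -> C) : cheb_f a != 0.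
Proof.
apply/prodf_neq0 => k _.
by apply: mulf_neq0; [exact: rfXsubC_neq0|rewrite invr_neq0 // one_sub_rfCX_neq0].
Qed.

(** The value of [cheb_f a] at [z]. *)
Definition blaschke n (a : 'I_n -> C) (z : C) : C :=
  \prod_(k < n | (a k != 1) && (a k != - 1))
    ((z - node_c (a k)) / (1 - node_c (a k) * z)).

(** Written in terms of [f_n ^+ 2] only, the quotient can be evaluated even at the
    zeros of [f_n], where [1 / f_n] has a pole; its poles are where [v ^+ 2 = -1]. *)
Lemma cheb_quotient_value n (a : 'I_n -> C) (x : C) : slit_plane x ->
  let z := x - sqrtx2m1 x in let v := blaschke a z in
  (forall k, a k != 1 -> a k != -1 -> 1 - node_c (a k) * z != 0) ->
  v * v + 1 != 0 ->
  rfregular (chebU a / chebT a) x /\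
  rfeval (chebU a / chebT a) x = (sqrtx2m1 x)^-1 * ((1 - v * v) / (1 + v * v)).
Proof.
move=> xs z v zc v0; have [sE _] := sqrtx2m1_inner xs.
have s0 : sqrtx2m1 x != 0 by rewrite -sqrf_eq0 sE slit_sqr_neq1.
have E := sqrt_roots sE.
have z0 : z != 0.
  by apply/negP => /eqP e; move: E; rewrite -/z e mul0r => /eqP; rewrite eq_sym oner_eq0.
have zV : z^-1 = x + sqrtx2m1 x by apply: (mulfI z0); rewrite divff.
have zJ : evalto z J x.
  have := evalto_joukowski z0; suff -> : 2^-1 * (z + z^-1) = x by [].
  by rewrite zV /z; field.
apply: (rfeval_comp JT zJ).
rewrite (rfcompM _ _ JT) (rfcompV _ JT) chebUE chebTE (cheb_quotient _ (cheb_f_neq0 a)).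
have fv : evalto z (cheb_f a) v.
  apply: evalto_prod => k /andP[k1 k2]; apply: evaltoM.
    exact: evaltoB (evaltoX _) (evaltoC _ _).
  apply: evaltoV; first exact: zc.
  by apply: evaltoB (evalto1 z) _; apply: evaltoM (evaltoC _ _) (evaltoX _).
have wE : z - z^-1 = - 2 * sqrtx2m1 x by rewrite zV /z; ring.
have -> : (sqrtx2m1 x)^-1 * ((1 - v * v) / (1 + v * v)) =
    2 / (z - z^-1) * ((v * v - 1) / (v * v + 1)).
  have v0' : 1 + v * v != 0 by rewrite addrC.
  by rewrite wE; field; rewrite ?s0 ?v0 ?v0'.
apply: evaltoM; first apply: evaltoM (evalto2 z) _.
  apply: evaltoV; first by rewrite wE mulf_neq0 // oppr_eq0 pnatr_eq0.
  by apply: evaltoB (evaltoX _) _; exact: evaltoV (evaltoX _).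
apply: evaltoM; first by apply: evaltoB (evalto1 z); exact: evaltoM.
by apply: evaltoV v0 _; apply: evaltoD (evalto1 z); exact: evaltoM.
Qed.

End ChebyshevValue.

(** * Sums and products over the roots of unity *)

Section RootsOfUnity.
Variables (F : fieldType) (n : nat) (a : 'I_n -> F).
Hypotheses (n_gt0 : (0 < n)%N) (a_inj : injective a)
  (a_root : forall k, n.-unity_root (a k)).

(** An injective map preserving the [n]-th roots of unity permutes them, and
    [n] distinct roots are all of them. *)
Lemma big_roots_reindex (T : Type) (idx : T) (op : Monoid.com_law idx)
    (s : F -> F) (P : pred F) (G : F -> T) :
  injective s -> (forall x, n.-unity_root x -> n.-unity_root (s x)) ->
  \big[op/idx]_(k < n | P (s (a k))) G (s (a k)) = \big[op/idx]_(k < n | P (a k)) G (a k).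
Proof.
move=> s_inj s_root.
rewrite -(big_map (fun k => s (a k)) P G) -(big_map a P G); apply: perm_big.
have ua (f : 'I_n -> F) : injective f -> (forall k, n.-unity_root (f k)) ->
    uniq (map f (index_enum 'I_n)) /\ n.-unity_root =i map f (index_enum 'I_n).
  move=> f_inj f_root.
  have u : uniq (map f (index_enum 'I_n)) by rewrite map_inj_uniq // index_enum_uniq.
  split=> //; apply: mem_unity_roots => //; first by apply/allP => _ /mapP[k _ ->].
  by rewrite size_map -[index_enum _]enumT size_enum_ord.
have [u1 m1] := ua _ a_inj a_root.
have [u2 m2] := ua (s \o a) (inj_comp s_inj a_inj) (fun k => s_root _ (a_root k)).
by apply: uniq_perm => // x; rewrite -m1 -m2.
Qed.

(** Multiplication by a root [w] permutes the roots, so the sum is fixed by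
    multiplication by [w ^+ 2]; for [n > 2] some root has [w ^+ 2 != 1]. *)
Lemma sum_roots_sqr : (2 < n)%N -> \sum_(k < n) a k ^+ 2 = 0.
Proof.
move=> n2; have [k wk] : exists k, a k ^+ 2 != 1.
  apply/existsP; rewrite -[[exists _, _]]negbK negb_exists; apply/negP => /forallP h.
  have hk k : (a k == 1) || (a k == -1) by rewrite -sqrf_eq1; have := h k; rewrite negbK.
  have : uniq (codom a) by apply/injectiveP.
  move/(@uniq_leq_size _ (codom a) [:: 1; -1]); rewrite size_codom card_ord.
  move=> le; suff : (n <= 2)%N by rewrite leqNgt n2.
  by apply: le => _ /codomP[k ->]; rewrite !inE.
have w0 : a k != 0.
  apply/negP => /eqP e; have := a_root k; rewrite e unity_rootE expr0n -[n]prednK //=.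
  by rewrite eq_sym oner_eq0.
have := @big_roots_reindex _ 0 +%R ( *%R (a k)) predT (fun x => x ^+ 2) (mulfI w0).
rewrite /=; under eq_bigr do rewrite exprMn.
rewrite -mulr_sumr => h.
have {}h : a k ^+ 2 * \sum_(k < n) a k ^+ 2 = \sum_(k < n) a k ^+ 2.
  apply: h => x; rewrite !unity_rootE exprMn => /eqP ->.
  by rewrite mulr1 -unity_rootE.
apply/eqP; move/eqP: h; rewrite -subr_eq0 -[X in _ - X]mul1r -mulrBl mulf_eq0 subr_eq0.
by rewrite (negPf wk).
Qed.

End RootsOfUnity.

(** A form of [1 - t <= 1 / (1 + t)] for products: a lower bound of the sum of the
    [x i] makes the product small. *)
Lemma prod_one_sub_le (R : realFieldType) (I : Type) (r : seq I) (P : pred I) (x : I -> R) :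
  (forall i, P i -> 0 <= x i <= 1) ->
  (\prod_(i <- r | P i) (1 - x i)) * (1 + \sum_(i <- r | P i) x i) <= 1.
Proof.
move=> x01.
suff : [/\ 0 <= \prod_(i <- r | P i) (1 - x i), 0 <= \sum_(i <- r | P i) x i &
  (\prod_(i <- r | P i) (1 - x i)) * (1 + \sum_(i <- r | P i) x i) <= 1] by case.
apply: (big_rec2 (fun p s => [/\ 0 <= p, 0 <= s & p * (1 + s) <= 1])).
  by rewrite addr0 mulr1.
move=> i p s /x01 /andP[x0 x1] [p0 s0 ps]; split; [|exact: addr_ge0|].
  by rewrite mulr_ge0 // subr_ge0.
apply: le_trans ps; rewrite [X in X <= _](_ : _ = p * ((1 - x i) * (1 + (x i + s)))); last ring.
by apply: ler_wpM2l => //; nra.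
Qed.

(** * Decay of the Blaschke products *)

Section Blaschke.
Variable R : realType.
Local Notation C := (R[i]).
Implicit Types (x y z c : C).

Lemma modsq_conj c : modsq c^*%C = modsq c.
Proof. by case: c => u v; rewrite /modsq /= sqrrN. Qed.

(** Shows that a Blaschke factor has modulus at most 1 in the disc, and by how much
    it falls short of 1. *)
Lemma blaschke_identity z c :
  modsq (1 - c^*%C * z) = modsq (z - c) + (1 - modsq z) * (1 - modsq c).
Proof. by case: z c => [p q] [u v]; rewrite /modsq /=; ring. Qed.

Lemma parallelogram x y : modsq (x + y) + modsq (x - y) = 2 * modsq x + 2 * modsq y.
Proof. by case: x y => [p q] [u v]; rewrite /modsq /=; ring. Qed.

Lemma modsqX x n : modsq (x ^+ n) = modsq x ^+ n.
Proof. by elim: n => [|n IH]; rewrite ?expr0 ?modsq1 // !exprS modsqM IH. Qed.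

Lemma unity_root_modsq n x : (0 < n)%N -> n.-unity_root x -> modsq x = 1.
Proof.
move=> n0; rewrite unity_rootE => /eqP /(congr1 (@modsq R)).
by rewrite modsqX modsq1 => /eqP; rewrite pexpr_eq1 ?modsq_ge0 // => /eqP.
Qed.

Lemma unimodular_slit x : modsq x = 1 -> x != 1 -> x != -1 -> slit_plane x.
Proof.
move=> x1 xn1 xN1; apply/slit_planeP; left; apply/negP => /eqP x0.
have xE : x = (complex.Re x)%:C%C by case: x x0 {x1 xn1 xN1} => p q /= ->.
move: x1; rewrite /modsq x0 expr0n addr0 => /eqP; rewrite sqrf_eq1 => /orP[] /eqP e.
  by move: xn1; rewrite xE e eqxx.
by move: xN1; rewrite xE e rmorphN1 eqxx.
Qed.

Lemma unimodular_modsq_sqr_sub1 x : modsq x = 1 ->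
  modsq (x ^+ 2 - 1) = 2 - 2 * complex.Re (x ^+ 2).
Proof.
move=> x1; have : modsq (x ^+ 2) = 1 by rewrite modsqX x1 expr1n.
case: (x ^+ 2) => p q; rewrite /modsq /= subr0 => pq; lra.
Qed.

Lemma node_c_conj x : slit_plane x -> node_c x^*%C = (node_c x)^*%C.
Proof.
move=> xs; have xs' : slit_plane x^*%C.
  by case: x xs => p q /slit_planeP h; apply/slit_planeP; rewrite /= oppr_eq0.
have [E1 l1] := sqrtx2m1_inner xs; have [E2 l2] := sqrtx2m1_inner xs'.
rewrite /node_c rmorphB; congr (_ - _); apply: (inner_unique E2) => //.
  by rewrite -rmorphXn E1 rmorphB rmorphXn rmorph1.
by rewrite -rmorphB modsq_conj.
Qed.

(** Put [u = |c|^2] and [t = |sqrt (x^2 - 1)|^2]. The parallelogram law for [x] and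
    [sqrt (x^2 - 1)] reads [u + 1/u = 2 + 2 t], that is [(1 - u)^2 = 2 t u]. As [t <= 2],
    [u >= 1/6], so [1 - u >= (1 - u)^2 >= t / 3 >= t^2 / 6]. *)
Lemma node_c_gap x : slit_plane x -> modsq x = 1 ->
  modsq (x ^+ 2 - 1) / 6 <= 1 - modsq (node_c x).
Proof.
move=> xs x1; have [E] := sqrtx2m1_inner xs.
have := congr1 (@modsq R) (sqrt_roots E); rewrite modsqM modsq1 -E modsqX.
have := parallelogram x (sqrtx2m1 x); rewrite x1.
have : modsq (sqrtx2m1 x) ^+ 2 <= 4.
  rewrite -modsqX E unimodular_modsq_sqr_sub1 //.
  have : modsq (x ^+ 2) = 1 by rewrite modsqX x1 expr1n.
  by case: (x ^+ 2) => p q; rewrite /modsq /= => pq; nra.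
have := modsq_ge0 (sqrtx2m1 x); have := modsq_ge0 (x + sqrtx2m1 x).
have := modsq_ge0 (x - sqrtx2m1 x); rewrite /node_c.
move: (modsq (x - sqrtx2m1 x)) (modsq (x + sqrtx2m1 x)) (modsq (sqrtx2m1 x)) => u U t u0 U0 t0 t4 uU uU1 u1.
have t2 : t <= 2 by nra.
have u6 : 1 <= 6 * u by nra.
have sq : (1 - u) ^+ 2 = 2 * t * u by rewrite -[in RHS]mulrA; nra.
have : t / 3 <= (1 - u) ^+ 2 by nra.
nra.
Qed.

Lemma one_sub_neq0 z c : modsq z < 1 -> modsq c < 1 -> 1 - c * z != 0.
Proof.
move=> z1 c1; rewrite subr_eq0; apply/negP => /eqP /(congr1 (@modsq R)) /esym /eqP.
by rewrite modsqM modsq1 lt_eqF // mulr_ilt1 ?modsq_ge0.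
Qed.

Lemma blaschke_factor_le z c : modsq z < 1 -> modsq c < 1 ->
  modsq (z - c) / modsq (1 - c^*%C * z) <= 1 - (1 - modsq z) * (1 - modsq c) / 4.
Proof.
move=> z1 c1.
have d0 : 0 < modsq (1 - c^*%C * z) by rewrite modsq_gt0 one_sub_neq0 // modsq_conj.
have d4 : modsq (1 - c^*%C * z) <= 4.
  have := parallelogram 1 (c^*%C * z); rewrite modsq1 modsqM modsq_conj.
  have := modsq_ge0 (1 + c^*%C * z).
  have : modsq c * modsq z <= 1 by rewrite mulr_ile1 ?modsq_ge0 ?ltW.
  lra.
rewrite ler_pdivrMr // mulrBl mul1r {1}blaschke_identity.
have : 0 <= (1 - modsq z) * (1 - modsq c) by rewrite mulr_ge0 // subr_ge0 ltW.
move: d0 d4; move: (modsq (1 - _)) ((1 - _) * _) => d e; nra.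
Qed.

(** Conjugation permutes the nodes, so each denominator [1 - c z] may be replaced
    by [1 - conj c * z]: the factors become Blaschke factors, which are bounded one by
    one. The nodes 1 and -1, left out of the product, have [a ^+ 2 - 1 = 0] and so may
    be included in the bounding product and sum. *)
Lemma blaschke_le n (a : 'I_n -> C) z : (2 < n)%N -> injective a ->
  (forall k, n.-unity_root (a k)) -> modsq z < 1 ->
  modsq (blaschke a z) * (1 + (1 - modsq z) / 12 * n%:R) <= 1.
Proof.
move=> n2 a_inj a_root z1; have n0 : (0 < n)%N by apply: ltn_trans n2.
have a1 k : modsq (a k) = 1 by exact: unity_root_modsq (a_root k).
(* 24 = 4 * 6, from [blaschke_factor_le] and [node_c_gap]; the sum of the [Y k] is
   2 n, whence the 12. *)
set tau := (1 - modsq z) / 24.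
have tau0 : 0 <= tau by rewrite divr_ge0 // subr_ge0 ltW.
have tau1 : tau * 24 <= 1.
  by rewrite divfK //; have := modsq_ge0 z; lra.
pose Y k := modsq (a k ^+ 2 - 1).
have Y4 k : 0 <= Y k <= 4.
  rewrite modsq_ge0 /Y unimodular_modsq_sqr_sub1 //=.
  have : modsq (a k ^+ 2) = 1 by rewrite modsqX a1 expr1n.
  by case: (a k ^+ 2) => p q; rewrite /modsq /= => pq; nra.
have sumY : \sum_(k < n) tau * Y k = (1 - modsq z) / 12 * n%:R.
  rewrite -mulr_sumr; under eq_bigr do rewrite /Y unimodular_modsq_sqr_sub1 //.
  rewrite sumrB sumr_const card_ord -mulr_sumr.
  have -> : \sum_(k < n) complex.Re (a k ^+ 2) = complex.Re (\sum_(k < n) a k ^+ 2).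
    by rewrite (raddf_sum (@complex.Re R)).
  by rewrite (sum_roots_sqr n0 a_inj a_root n2) /= mulr0 subr0 -mulr_natr /tau; field.
have le1 : \prod_(k < n) (1 - tau * Y k) * (1 + (1 - modsq z) / 12 * n%:R) <= 1.
  rewrite -sumY; apply: prod_one_sub_le.
  by move=> k _; have /andP[y0 y4] := Y4 k; rewrite mulr_ge0 //=; nra.
apply: le_trans le1; apply: ler_wpM2r.
  by rewrite addr_ge0 // mulr_ge0 // divr_ge0 // subr_ge0 ltW.
pose Q x := (x != 1) && (x != -1) : bool.
have slit k : Q (a k) -> slit_plane (a k) by move=> /andP[? ?]; exact: unimodular_slit.
have -> : modsq (blaschke a z) = \prod_(k < n | Q (a k))
    (modsq (z - node_c (a k)) / modsq (1 - (node_c (a k))^*%C * z)).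
  rewrite /blaschke (big_morph (@modsq R) (@modsqM R) (@modsq1 R)).
  under eq_bigr do rewrite modsqM modsqV.
  rewrite !prodf_div; congr (_ / _).
  rewrite -(@big_roots_reindex C n a n0 a_inj a_root _ 1 *%R (@conjc R) Q
    (fun x => modsq (1 - node_c x * z))) /=.
  - have QJ k : Q (a k)^*%C = Q (a k).
      rewrite /Q -{1}(rmorph1 (@conjc R)) -{1}(rmorphN1 (@conjc R)).
      by rewrite !(inj_eq (can_inj (@conjcK R))).
    by apply: eq_big => k; rewrite QJ // => Qk; rewrite (node_c_conj (slit k Qk)).
  - exact: (can_inj (@conjcK R)).
  - by move=> x; rewrite !unity_rootE -rmorphXn => /eqP ->; rewrite rmorph1.
rewrite [X in _ <= X](bigID (Q \o a)) /= [X in _ <= _ * X]big1 ?mulr1; last first.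
  move=> k; rewrite negb_and !negbK -sqrf_eq1 => /eqP e.
  by rewrite /Y e subrr /modsq /= expr0n addr0 mulr0 subr0.
apply: ler_prod => k Qk; rewrite divr_ge0 ?modsq_ge0 //=.
have [_ c1] := sqrtx2m1_inner (slit k Qk).
apply: le_trans (blaschke_factor_le z1 c1) _.
have := node_c_gap (slit k Qk) (a1 k); rewrite -/(Y k) /node_c /tau.
move: (modsq (_ - _)) (Y k) => u y; nra.
Qed.

End Blaschke.

(** * Convergence *)

Section Convergence.
Variable R : realType.
Local Notation C := (R[i]).

Lemma uniform_cvg_modulus (A : set C) (r : nat -> C -> C) (f : C -> C) :
  (forall e : R, 0 < e ->
    \forall n \near \oo, forall x, A x -> modulus (r n x - f x) < e) ->
  {uniform A, (fun n => r n : C -> C^o) @ \oo --> (f : C -> C^o)}.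
Proof.
move=> h P /uniform_nbhs[E [+ EP]].
rewrite -entourage_from_ballE => -[e /= e0 eE].
have eE' : e = (complex.Re e)%:C%C by rewrite RRe_real // gtr0_real.
have re0 : 0 < complex.Re e by rewrite -ltcR -eE'.
apply: filterS (h _ re0) => n nP; apply: EP => x Ax; apply: eE.
by rewrite /ball /= norm_modulus eE' ltcR -opprB modulusN; exact: nP.
Qed.

Lemma eventually_nat_ge (M : R) : \forall n \near \oo, M <= n%:R.
Proof.
exists (Num.trunc M).+1 => // n /= Mn; apply: le_trans (ltW (truncnS_gt M)) _.
by rewrite ler_nat.
Qed.

Lemma cheb_quotient_error (s v : C) : modsq v <= 1 / 2 -> s != 0 ->
  modulus (s^-1 * ((1 - v * v) / (1 + v * v)) - s^-1) <= 4 * modsq v / modulus s.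
Proof.
move=> v2 s0; have vv : modulus (v * v) = modsq v by rewrite modulusM -expr2 modulus_sqr.
have ge : 1 / 2 <= modulus (1 + v * v).
  have := modulusD (1 + v * v) (- (v * v)); rewrite addrK modulusN vv modulus1; lra.
have d0 : 1 + v * v != 0 by rewrite -modulus_gt0; lra.
have -> : s^-1 * ((1 - v * v) / (1 + v * v)) - s^-1 = s^-1 * (- 2 * (v * v) / (1 + v * v)).
  by field; rewrite s0 d0.
rewrite !modulusM !modulusV mulrC; apply: ler_wpM2r.
  by rewrite invr_ge0 modulus_ge0.
have -> : modulus (- 2 : C) = 2.
  by rewrite modulusN -(rmorph_nat (real_complex R)) modulus_real ger0_norm.
rewrite -modulusM vv ler_pdivrMr; last lra.
have := modsq_ge0 v; nra.
Qed.

End Convergence.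

Theorem theorem6p3 (R : realType) (a : forall n : nat, 'I_n -> R[i])
    (a_inj : forall n : nat, (0 < n)%N -> injective (a n))
    (a_root : forall (n : nat) (k : 'I_n), (0 < n)%N -> n.-unity_root (a n k)) :
  rf_cvg_locally_uniformly (@slit_plane R)
    (fun n => chebU (a n) / chebT (a n))
    (fun x => (sqrtx2m1 x)^-1).
Proof.
move=> x0 xs0; have [sE0 z1] := sqrtx2m1_inner xs0.
set s := @sqrtx2m1 R in sE0 z1 *.
rewrite -modulus_lt1 in z1; set q := modulus (x0 - s x0) in z1.
have q0 : 0 <= q := modulus_ge0 _.
have m0 : 0 < modulus (s x0).
  by rewrite modulus_gt0 -sqrf_eq0 sE0 slit_sqr_neq1.
set m := modulus (s x0) in m0.
have [e [e0 eq em]] : exists e : R, [/\ 0 < e, e <= (1 - q) / 4 & e <= m / 2].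
  exists (Num.min ((1 - q) / 4) (m / 2)); rewrite lt_min !ge_min !lexx orbT.
  by split=> //; apply/andP; split; lra.
(* On a neighbourhood [V] of [x0], [z = x - s x] stays in a disc of radius
   [rho < 1] and [s x] stays away from 0. *)
have [d d0 dP] := sqrt_branch_continuous (sqrtx2m1_branch R) xs0 e0.
pose rho := (1 + q) / 2.
have rho1 : rho < 1 by rewrite /rho; lra.
have rho0 : 0 <= rho by rewrite /rho; lra.
pose V := [set x : R[i] | modulus (x - x0) < Num.min d ((1 - q) / 4)].
have VP x : V x -> modsq (x - s x) <= rho ^+ 2 /\ m / 2 <= modulus (s x).
  rewrite /V /= lt_min => /andP[xd xq]; have := dP x xd; rewrite -/s => sx.
  split.
    rewrite -modulus_sqr; apply: lerXn2r; rewrite ?nnegrE ?modulus_ge0 //.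
    have := modulusD (x0 - s x0) ((x - x0) - (s x - s x0)).
    have -> : x0 - s x0 + ((x - x0) - (s x - s x0)) = x - s x by ring.
    have := modulusD (x - x0) (- (s x - s x0)); rewrite modulusN -/q /rho; lra.
  have := modulusD (s x) (- (s x - s x0)); rewrite modulusN.
  have -> : s x + - (s x - s x0) = s x0 by ring.
  rewrite -/m; lra.
pose tau := (1 - rho ^+ 2) / 12.
have rho21 : rho ^+ 2 < 1 by rewrite expr_lt1.
have tau0 : 0 < tau by rewrite divr_gt0 // subr_gt0.
have small (eta : R) : 0 < eta -> \forall n \near \oo, (2 < n)%N /\ forall x,
    V x -> modsq (blaschke (a n) (x - s x)) <= eta.
  move=> eta0; near=> n.
  have n2 : (2 < n)%N by near: n; exists 3%N.
  have n0 : (0 < n)%N by apply: ltn_trans n2.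
  have nM : (eta * tau)^-1 <= n%:R by near: n; exact: eventually_nat_ge.
  split=> // x /VP[zr _]; have z1' : modsq (x - s x) < 1 by apply: le_lt_trans zr _.
  have := blaschke_le n2 (@a_inj n n0) (fun k => a_root n k n0) z1'.
  have tn : 1 <= eta * (tau * n%:R).
    by rewrite mulrA -(ler_pdivrMl _ _ (mulr_gt0 eta0 tau0)) mulr1.
  set b := modsq (blaschke _ _).
  have b0 : 0 <= b := modsq_ge0 _.
  have : tau <= (1 - modsq (x - s x)) / 12 by rewrite /tau; lra.
  move: ((1 - modsq (x - s x)) / 12) => t tt bt.
  have nn : 0 <= n%:R :> R by [].
  have h1 : tau * n%:R <= t * n%:R by apply: ler_wpM2r.
  have h2 : 0 <= tau * n%:R by rewrite mulr_ge0 // ltW.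
  move: h1 h2 tn bt; move: (tau * n%:R) (t * n%:R) => u w; nra.
have value n x : (2 < n)%N -> V x -> slit_plane x ->
    modsq (blaschke (a n) (x - s x)) <= 1 / 2 ->
  rfregular (chebU (a n) / chebT (a n)) x /\
  modulus (rfeval (chebU (a n) / chebT (a n)) x - (s x)^-1)
    <= 8 / m * modsq (blaschke (a n) (x - s x)).
  move=> n2 Vx xs b2; have n0 : (0 < n)%N by apply: ltn_trans n2.
  have [zr sm] := VP x Vx.
  have zn1 : modsq (x - s x) < 1 by apply: le_lt_trans zr _.
  have [k k1 kN1| |reg ->] := @cheb_quotient_value R n (a n) x xs.
  - apply: one_sub_neq0 => //.
    by apply: (sqrtx2m1_inner _).2; apply: unimodular_slit k1 kN1; apply: unity_root_modsq (a_root n k n0).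
  - apply/negP => /eqP /(canRL (addrK _)); rewrite sub0r => /(congr1 (@modulus R)).
    by rewrite modulusM -expr2 modulus_sqr modulusN modulus1 -/s; move: b2 => /[swap] ->; lra.
  split=> //; rewrite -/s.
  have s0 : s x != 0 by rewrite -modulus_gt0; lra.
  apply: le_trans (cheb_quotient_error b2 s0) _.
  move: (modsq_ge0 (blaschke (a n) (x - s x))); move: (modsq _) => b b0.
  rewrite ler_pdivrMr; last lra.
  have -> : 8 / m * b * modulus (s x) = 4 * b * (modulus (s x) * 2 / m) by ring.
  by rewrite ler_peMr ?mulr_ge0 // ler_pdivlMr //; lra.
exists V.
  by apply: nbhs_modulus; exists (Num.min d ((1 - q) / 4)) => //; rewrite lt_min d0; lra.
split.
  have half : 0 < 1 / 2 :> R by lra.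
  apply: filterS (small _ half) => n [n2 h] x [Vx xs].
  by have [] := value n x n2 Vx xs (h x Vx).
apply: uniform_cvg_modulus => eps eps0.
have [eta [eta0 eta2 etae]] : exists eta : R, [/\ 0 < eta, eta <= 1 / 2 & 8 / m * eta < eps].
  exists (Num.min (1 / 2) (m * eps / 16)); split.
  - by rewrite lt_min !divr_gt0 // mulr_gt0.
  - by rewrite ge_min lexx.
  - apply: (@le_lt_trans _ _ (8 / m * (m * eps / 16))).
      by apply: ler_wpM2l; rewrite ?ge_min ?lexx ?orbT // divr_ge0 // ltW.
    have -> : 8 / m * (m * eps / 16) = eps / 2 by field; rewrite gt_eqF.
    lra.
apply: filterS (small _ eta0) => n [n2 h] x [Vx xs].
have [_] := value n x n2 Vx xs (le_trans (h x Vx) eta2).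
move=> /le_lt_trans; apply; apply: le_lt_trans etae.
by apply: ler_wpM2l (h x Vx); rewrite divr_ge0 // ltW.
Unshelve. all: by end_near. Qed.
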